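(* Let $\phi$ be a Sturmian coloring of bounded type of a $k$-regular tree $T$, and let $m=\min\{\tau(x):x\in VT\}$. Let $X=T/\sim$ be the quotient of $T$ obtained by identifying vertices with the same maximal type, with vertices of $X$ labelled by their maximal type, and let $\pi:T\to X$ be the canonical quotient map. Then $X$ is a proper infinite quotient graph of $T$ with $$VX=\{m,m+1,m+2,\dots\},\qquad EX\subset\{[i,i+1],[i+1,i]\;:\;i\ge m\}\cup\{[i,i]\;:\;i\ge m\},$$ and there is a coloring $\phi_X$ on $X$ (i.e. of $VX$) such that $\phi=\phi_X\circ\pi$.
   Context: $T$ is a $k$-regular tree ($k\ge 2$) with vertex set $VT$. A coloring is a map $\phi:VT\to\mathcal{A}$ with $\mathcal{A}$ a countable set. $B_n(x)$ is the ball of radius $n$ around the vertex $x$ (edges of length $1$). $[B_n(x)]$ denotes the equivalence class of $B_n(x)$ under color-preserving graph isomorphisms between $n$-balls (a colored $n$-ball). $b_\phi(n)$ is the number of distinct colored $n$-balls in $T$; $\phi$ is Sturmian if $b_\phi(n)=n+2$ for all $n\ge 0$. A colored $n$-ball $[B]$ is special if there are vertices $x,y$ with $[B_n(x)]=[B_n(y)]=[B]$ and $[B_{n+1}(x)]\ne[B_{n+1}(y)]$. The type set of a vertex $x$ is $\Lambda_x=\{n\ge 0:[B_n(x)]\text{ is special}\}$. A vertex is of bounded type if $\Lambda_x$ is finite; then its maximal type $\tau(x)$ is $\max\Lambda_x$, or $-1$ if $\Lambda_x=\emptyset$. The coloring is of bounded type if some vertex is of bounded type (in which case every vertex is). The relation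 $\sim$ on $VT$ is: $v\sim w$ iff $\tau(v)=\tau(w)$. The graph $X=T/\sim$ has vertex set $VX=VT/\sim$ and oriented edge set $EX$ consisting of the pairs $[\pi(v),\pi(w)]$ for $v,w$ adjacent in $T$. ''Proper'' means that the quotient map $\pi$ is not injective. *)

(* Defs.v *)
From HB Require Import structures.
From mathcomp Require Import all_boot all_order all_algebra.
From mathcomp Require Import boolp classical_sets functions cardinality.
Set Implicit Arguments.
Unset Strict Implicit.
Unset Printing Implicit Defensive.
Import Order.TTheory GRing.Theory Num.Theory.
Local Open Scope classical_set_scope.
Local Open Scope ring_scope.
Local Open Scope quotient_scope.
Local Open Scope card_scope.

Section Tree.
Context {V : choiceType} (adj : rel V).

Definition connected_graph : Prop :=
  forall x y : V, exists2 p : seq V, path adj x p & last x p = y.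

(* In a simple graph an edge traversed back and forth is a [ucycle] of
   size 2; genuine cycles have at least 3 vertices. *)
Definition acyclic_graph : Prop :=
  forall c : seq V, ucycle adj c -> (size c < 3)%N.

Definition regular_graph (k : nat) : Prop :=
  forall x : V, [set y | adj x y] #= `I_k.

Definition regular_tree (k : nat) : Prop :=
  [/\ symmetric adj, irreflexive adj, connected_graph, acyclic_graph
    & regular_graph k].

Definition ball (n : nat) (x : V) : set V :=
  [set y | exists p : seq V, [/\ path adj x p, last x p = y & (size p <= n)%N]].

End Tree.

Section Coloring.
Context {V : choiceType} {A : countType} (adj : rel V) (phi : V -> A).

(* Isomorphism of the induced colored subgraphs; nothing is required about
   the centers of balls. *)
Definition colored_iso (P Q : set V) : Prop :=
  exists f : V -> V,
    [/\ set_bij P Q f,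
        forall u v, P u -> P v -> adj (f u) (f v) = adj u v
      & forall u, P u -> phi (f u) = phi u].

Definition colored_ball (n : nat) (x : V) : set (set V) :=
  [set B | range (ball adj n) B /\ colored_iso (ball adj n x) B].

Definition sturmian : Prop :=
  forall n : nat, range (colored_ball n) #= `I_(n + 2).

Definition special (n : nat) (C : set (set V)) : Prop :=
  exists x y : V, [/\ colored_ball n x = C, colored_ball n y = C
    & colored_ball n.+1 x <> colored_ball n.+1 y].

Definition type_set (x : V) : set nat :=
  [set n | special n (colored_ball n x)].

Definition bounded_vertex (x : V) : Prop := finite_set (type_set x).

Definition bounded_type : Prop := exists x : V, bounded_vertex x.

Definition is_max (S : set int) (t : int) : Prop := S t /\ ubound S t.
Definition is_min (S : set int) (t : int) : Prop := S t /\ lbound S t.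

(* [xget] returns the default -1 when there is no maximum: this is the
   convention for an empty type set, and a junk value for an infinite one. *)
Definition max_type (x : V) : int :=
  xget (-1) (is_max [set n%:Z | n in type_set x]).

Definition same_type : rel V := fun v w => max_type v == max_type w.

Lemma same_type_refl : reflexive same_type.
Proof. by move=> v; exact: eqxx. Qed.

Lemma same_type_sym : symmetric same_type.
Proof. by move=> v w; exact: eq_sym. Qed.

Lemma same_type_trans : transitive same_type.
Proof. by move=> w v u /eqP vw /eqP wu; apply/eqP; rewrite vw. Qed.

Definition same_type_equiv : equiv_rel V :=
  EquivRel same_type same_type_refl same_type_sym same_type_trans.

Definition quotient_vertex : Type := {eq_quot same_type_equiv}.

Definition quotient_map (v : V) : quotient_vertex :=
  \pi_({eq_quot same_type_equiv}) v.

Definition quotient_edges : set (quotient_vertex * quotient_vertex) :=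
  [set E | exists v w : V, adj v w /\ E = (quotient_map v, quotient_map w)].

Definition label (q : quotient_vertex) : int :=
  max_type (repr (q : {eq_quot same_type_equiv})).

Lemma label_quotient_map (v : V) : label (quotient_map v) = max_type v.
Proof.
rewrite /label /quotient_map; apply/eqP.
change (same_type_equiv (repr (\pi_({eq_quot same_type_equiv}) v)) v).
by apply/eqmodP; rewrite reprK.
Qed.

End Coloring.

Arguments quotient_edges {V A} adj phi.
Arguments label {V A} adj phi q.

(* Main.v *)
(* A class of n-balls is final at level n if no vertex in it has its class split
   at any level >= n.  Since b(n+1) = b(n) + 1, exactly one class S_n splits at
   level n, and into exactly two.  Two observations give everything.
   - A class of (n+1)-balls determines the classes of the n-balls around the
     neighbors of its center.  So the distance to S_n is a function of the class
     of the n-ball, hence bounded on the tree; as the number of classes is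
     unbounded, S_n contains vertices arbitrarily far from any given finite set
     of final classes.
   - Hence the two halves of S_n are not both final, so that tau separates the
     final classes; and if x, y are adjacent, then tau(y) >= tau(x) + 2 is
     impossible, as every vertex of S_tau(y) would be adjacent to the final class
     of x.
   Connectedness propagates bounded type to all vertices, and since tau is
   unbounded and changes by at most 1 along edges, it takes all values >= m. *)
Require Import Defs.
From mathcomp Require Import all_boot all_order all_algebra.
From mathcomp Require Import boolp classical_sets functions cardinality.
Import Order.TTheory GRing.Theory Num.Theory.
Local Open Scope classical_set_scope.
Local Open Scope ring_scope.

(** * Finite counting *)

Lemma card_eq_ord (T : Type) (A : set T) (n : nat) : (A #= `I_n)%card ->
  exists r : 'I_n -> T,
    [/\ injective r, forall i, A (r i) & forall a, A a -> exists i, r i = a].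
Proof.
rewrite card_eq_sym => /card_bijP[f [g fK gK]].
pose toI (i : 'I_n) : `I_n := SigSub (mem_set (ltn_ord i : `I_n i)).
exists (fun i => \val (f (toI i))); split.
- by move=> i j /val_inj /(can_inj fK) /(congr1 val) /= /val_inj.
- by move=> i; exact/set_mem/(valP (f _)).
- move=> a Aa; pose b := g (SigSub (mem_set Aa)).
  have bn : (val b < n)%N by exact: (set_mem (valP b)).
  exists (Ordinal bn); rewrite (_ : toI _ = b) ?gK//.
  exact: val_inj.
Qed.

(** Dropping one point of a colliding pair leaves a map on [n] points that is still onto, hence
    injective by counting. So every collision involves both points of the pair. *)
Lemma surjection_ord_collapse (n : nat) (h : 'I_n.+1 -> 'I_n) :
  (forall j, exists i, h i = j) ->
  exists i j, [/\ i != j, h i = h j &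
    forall p q, p != q -> h p = h q -> p = i \/ p = j].
Proof.
move=> hS.
have [i [j [nij hij]]] : exists i j, i != j /\ h i = h j.
  apply: contrapT => H; have /leq_card : injective h.
    by move=> i j hij; apply: contrapT => /eqP nij; apply: H; exists i, j.
  by rewrite !card_ord ltnn.
have inj_off a b : a != b -> h a = h b -> {in [set~ b]%SET &, injective h}.
  move=> nab hab; apply/imset_injP; rewrite cardsC1 card_ord /=.
  suff -> : [set h x | x in [set~ b]%SET]%SET = [set: 'I_n]%SET by rewrite cardsT card_ord.
  apply/setP => c; rewrite inE; apply/imsetP.
  have [x <-] := hS c; have [->|nxb] := eqVneq x b.
    by exists a; rewrite ?inE.
  by exists x; rewrite ?inE.
have Ij := inj_off i j nij hij.
have Ii : {in [set~ i]%SET &, injective h} by apply: (inj_off j i); rewrite // eq_sym.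
exists i, j; split=> // p q npq hpq.
have [->|npi] := eqVneq p i; first by left.
have [->|npj] := eqVneq p j; first by right.
have [qi|nqi] := eqVneq q i; last first.
  by case/eqP: npq; apply: Ii; rewrite ?inE.
by case/eqP: npq; apply: Ij; rewrite ?inE// qi.
Qed.

(** * Balls and colored isomorphisms in an arbitrary graph *)

Section Balls.
Set Implicit Arguments. Unset Strict Implicit.
Context {V : choiceType} {A : countType} (adj : rel V) (phi : V -> A).

Lemma ball_center (n : nat) (x : V) : ball adj n x x.
Proof. by exists [::]. Qed.

Lemma ball0 (x y : V) : ball adj 0 x y -> y = x.
Proof. by case=> -[|? ?] []. Qed.

Lemma ball_le (m n : nat) (x : V) : (m <= n)%N -> ball adj m x `<=` ball adj n x.
Proof. by move=> mn y [p [xp py sp]]; exists p; split=> //; apply: leq_trans mn. Qed.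

Lemma ball_adj (n : nat) (x y z : V) :
  ball adj n x y -> adj y z -> ball adj n.+1 x z.
Proof.
move=> [p [xp <- sp]] yz; exists (rcons p z).
by rewrite rcons_path xp yz last_rcons size_rcons.
Qed.

(** [colored_iso] with its map exposed, so that one map can be inverted and restricted to smaller
    balls. *)
Definition is_colored_iso (P Q : set V) (f : V -> V) : Prop :=
  [/\ set_bij P Q f,
      forall u v, P u -> P v -> adj (f u) (f v) = adj u v
    & forall u, P u -> phi (f u) = phi u].

Lemma is_colored_iso_inv (P Q : set V) (f : V -> V) :
  is_colored_iso P Q f ->
  exists g, [/\ is_colored_iso Q P g, {in P, cancel f g} & {in Q, cancel g f}].
Proof.
move=> [[fPQ fI fS] fadj fphi].
have /choice[g gP] : forall v, exists u, Q v -> P u /\ f u = v.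
  move=> v; have [/fS[u Pu fu]|nQ] := pselect (Q v); first by exists u.
  by exists v.
have gK v : Q v -> f (g v) = v by move=> /gP[].
have fK u : P u -> g (f u) = u.
  move=> Pu; have [Pg e] := gP _ (fPQ _ Pu).
  by apply: fI; rewrite ?inE.
exists g; split.
- split; first split.
  + by move=> v /gP[].
  + by move=> u v /[!inE] Qu Qv e; rewrite -(gK u)// -(gK v)// e.
  + move=> u Pu; exists (f u); last exact: fK.
    exact: fPQ.
  + move=> u v Qu Qv; have [[Pu eu] [Pv ev]] := (gP _ Qu, gP _ Qv).
    by rewrite -fadj// eu ev.
  + by move=> u Qu; have [Pu eu] := gP _ Qu; rewrite -fphi// eu.
- by move=> u /[!inE]; apply: fK.
- by move=> u /[!inE]; apply: gK.
Qed.

Lemma colored_iso_refl (P : set V) : colored_iso adj phi P P.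
Proof.
exists id; split=> //; split=> //.
by move=> x Px; exists x.
Qed.

Lemma colored_iso_sym (P Q : set V) :
  colored_iso adj phi P Q -> colored_iso adj phi Q P.
Proof. by move=> [f /is_colored_iso_inv[g [gP _ _]]]; exists g. Qed.

Lemma colored_iso_trans (P Q S : set V) :
  colored_iso adj phi P Q -> colored_iso adj phi Q S -> colored_iso adj phi P S.
Proof.
move=> [f [[f1 f2 f3] fadj fphi]] [g [[g1 g2 g3] gadj gphi]].
have fQ u : P u -> Q (f u) by move=> /f1.
exists (g \o f); split; first split.
- by move=> u Pu; apply: g1; apply: fQ.
- move=> u v /[!inE] Pu Pv /g2 e; apply: f2; rewrite ?inE//.
  by apply: e; rewrite inE; apply: fQ.
- move=> s /g3[q /f3[p Pp <-] <-]; by exists p.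
- by move=> u v Pu Pv /=; rewrite gadj ?fadj//; apply: fQ.
- by move=> u Pu /=; rewrite gphi ?fphi//; apply: fQ.
Qed.

Lemma colored_ballP (n : nat) (x y : V) :
  colored_ball adj phi n x = colored_ball adj phi n y <->
  colored_iso adj phi (ball adj n x) (ball adj n y).
Proof.
split=> [e|i].
  suff [_ //] : colored_ball adj phi n x (ball adj n y).
  by rewrite e; split; [exists y | exact: colored_iso_refl].
apply/seteqP; split=> B [rB j]; split=> //.
  exact: colored_iso_trans (colored_iso_sym i) j.
exact: colored_iso_trans i j.
Qed.

Lemma is_colored_iso_restr (P Q P' Q' : set V) (f g : V -> V) :
  is_colored_iso P Q f -> {in Q, cancel g f} -> P' `<=` P -> Q' `<=` Q ->
  (forall u, P' u -> Q' (f u)) -> (forall v, Q' v -> P' (g v)) ->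
  is_colored_iso P' Q' f.
Proof.
move=> [[f1 f2 f3] fadj fphi] gK PP QQ fP gQ; split; first split.
- exact: fP.
- by move=> u v /[!inE] Pu Pv; apply: f2; rewrite inE; apply: PP.
- by move=> v Qv; exists (g v); [exact: gQ | apply: gK; rewrite inE; apply: QQ].
- by move=> u v Pu Pv; apply: fadj; apply: PP.
- by move=> u Pu; apply: fphi; apply: PP.
Qed.

End Balls.
Arguments ball_le {V adj m n x}.
Arguments colored_ballP {V A adj phi n x y}.

(** * Rigidity of ball isomorphisms in a regular tree *)

Section ColoredTree.
Set Implicit Arguments. Unset Strict Implicit.
Set Implicit Arguments. Unset Strict Implicit.
Context {V : choiceType} {A : countType} (adj : rel V) (phi : V -> A) (k : nat).
Context (hk : (2 <= k)%N) (hT : regular_tree adj k).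

Let adjC : symmetric adj. Proof. by case: hT. Qed.

Lemma neighbors_seq (x : V) : exists s : seq V, forall y, adj x y -> y \in s.
Proof.
have [_ _ _ _ /(_ x) hc] := hT.
have /finite_seqP[s sE] : finite_set [set y | adj x y] by exists k.
exists s => y xy; have : [set y | adj x y] y by [].
by rewrite sE.
Qed.

Lemma two_neighbors (x : V) : exists y z, [/\ adj x y, adj x z & y <> z].
Proof.
have [_ _ _ _ /(_ x)/card_eq_ord[r [rI rx _]]] := hT.
exists (r (Ordinal (ltn_trans (ltnSn 0) hk))), (r (Ordinal hk)).
by split=> [||/rI//]; exact: rx.
Qed.

(* Otherwise the walk [p, ..., x, ..., q] avoids [u] and closes up to a cycle. *)
Lemma leaf_neighbor_unique (n : nat) (x u p q : V) :
  ~ ball adj n x u -> adj u p -> adj u q ->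
  ball adj n.+1 x p -> ball adj n.+1 x q -> p = q.
Proof.
move=> nu up uq Bp Bq; apply/eqP; apply: contraT => npq.
have [_ irr _ acyc _] := hT.
pose e := [rel a b | [&& adj a b, a != u & b != u]].
have eC : symmetric e by move=> a b; rewrite /= adjC andbA andbAC -andbA.
have walk v : v != u -> ball adj n.+1 x v ->
    exists2 s, path e x s & last x s = v.
  move=> vu [s [xs sv ss]]; exists s => //.
  (* Lying outside the [n]-ball, [u] could only be the last vertex of a walk of length at most
     [n.+1], and that vertex is [v]. *)
  have prefix_ne s1 s2 : s = s1 ++ s2 -> last x s1 != u.
    move=> es; case: (lastP s2) es => [|s2' z] es.
      by rewrite cats0 in es; rewrite -es sv.
    apply/eqP => lu; apply: nu; exists s1; split=> //.
      by move: xs; rewrite es cat_path => /andP[].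
    by move: ss; rewrite es size_cat size_rcons addnS ltnS; apply: leq_trans; rewrite leq_addr.
  have {vu sv ss}H : forall s1 s2, s = s1 ++ s2 -> path e (last x s1) s2.
    move=> s1 s2; elim: s2 s1 => [//|z s2 IH] s1 es /=.
    have := IH (rcons s1 z); rewrite cat_rcons last_rcons => -> //.
    rewrite (prefix_ne s1 (z :: s2))// andbT /=.
    have := prefix_ne (rcons s1 z) s2; rewrite cat_rcons last_rcons => -> //.
    by move: xs; rewrite es cat_path /= => /and3P[_ ->].
  exact: (H [::] s).
have ne v : adj u v -> v != u by move=> uv; apply/eqP => vu; rewrite vu irr in uv.
have [s1 xs1 l1] := walk _ (ne _ up) Bp.
have [s2 xs2 l2] := walk _ (ne _ uq) Bq.
have [s [ps ls]] : exists s, path e p s /\ last p s = q.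
  exists (rev (belast x s1) ++ s2); rewrite cat_path -l1 last_cat.
  have -> : last (last x s1) (rev (belast x s1)) = x.
    by case: s1 {xs1 l1} => //= z s1; rewrite rev_cons last_rcons.
  by rewrite rev_path xs2 (eq_path (e' := e)) ?xs1 // => a b; rewrite /= eC.
case/shortenP: ps ls => s' ps' us' _ ls'.
have := acyc (u :: p :: s').
have adjs : path adj p s' by apply: sub_path ps' => a b /and3P[].
have nus : u \notin p :: s'.
  rewrite inE negb_or eq_sym (ne _ up) /=; elim: s' p {up Bp npq l1 us' ls' adjs} ps' => //= z s' IH p'.
  by move=> /andP[/and3P[_ _ zu] /IH]; rewrite inE negb_or eq_sym zu.
case: s' ps' us' ls' adjs nus => [|z s'] ps' us' ls' adjs nus.
  by move: npq; rewrite -ls' eqxx.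
move=> H; suff /H : ucycle adj [:: u, p, z & s'] by [].
rewrite /ucycle /cycle rcons_path; apply/andP; split; last by rewrite cons_uniq nus.
by move: adjs ls' => /= adjs ls'; rewrite up adjs ls' adjC.
Qed.

(** Degrees tell the layers apart: a vertex of the [n]-ball has at least two neighbors in the
    [n.+1]-ball (as [k >= 2]), a vertex at distance [n.+1] only one. *)
Lemma iso_ball_interior (n : nat) (x y : V) (f : V -> V) :
  is_colored_iso adj phi (ball adj n.+1 x) (ball adj n.+1 y) f ->
  forall u, ball adj n x u -> ball adj n y (f u).
Proof.
move=> [[f1 f2 _] fadj _] u xu; have xSu := ball_le (leqnSn n) _ xu.
have [p [q [up uq npq]]] := two_neighbors u.
have [xp xq] := (ball_adj xu up, ball_adj xu uq).
apply: contrapT => nfu; apply/npq/f2; rewrite ?inE//.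
by apply: (leaf_neighbor_unique nfu); rewrite ?fadj//; apply: f1.
Qed.

Lemma iso_ball_pred (n : nat) (x y : V) (f : V -> V) :
  is_colored_iso adj phi (ball adj n.+1 x) (ball adj n.+1 y) f ->
  is_colored_iso adj phi (ball adj n x) (ball adj n y) f.
Proof.
move=> fP; have [g [gP _ gK]] := is_colored_iso_inv fP.
apply: (is_colored_iso_restr fP gK); try exact: ball_le.
- exact: iso_ball_interior fP.
- exact: iso_ball_interior gP.
Qed.

(** Peeling off one layer at a time leads to radius 0. Centers are thus respected although the
    definition does not ask for it. *)
Lemma iso_ball_center (n : nat) (x y : V) (f : V -> V) :
  is_colored_iso adj phi (ball adj n x) (ball adj n y) f -> f x = y.
Proof.
elim: n => [|n IH] fP; last exact/IH/iso_ball_pred.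
by case: fP => -[f1 _ _] _ _; apply/(@ball0 _ adj)/f1/ball_center.
Qed.

Lemma iso_ball_path (n : nat) (x y : V) (f : V -> V) :
  is_colored_iso adj phi (ball adj n x) (ball adj n y) f ->
  forall p i a, ball adj i x a -> (i + size p <= n)%N -> path adj a p ->
    path adj (f a) (map f p).
Proof.
move=> [_ fadj _]; elim=> [//|b p IH] i a xa /= ip /andP[ab bp].
have xb := ball_adj xa ab; rewrite addnS -addSn in ip.
have lei := leq_trans (leq_addr _ _) ip.
rewrite fadj ?ab ?(IH i.+1)//; last exact: ball_le lei _ xb.
exact: ball_le (ltnW lei) _ xa.
Qed.

Lemma iso_ball_neighbor (n : nat) (x y u v : V) (f : V -> V) :
  is_colored_iso adj phi (ball adj n.+1 x) (ball adj n.+1 y) f ->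
  adj x u -> ball adj n u v -> ball adj n (f u) (f v).
Proof.
move=> fP xu [p [up <- sp]]; exists (map f p).
rewrite last_map size_map; split=> //.
exact: (iso_ball_path fP (ball_adj (ball_center adj 0 x) xu)).
Qed.

Lemma ball_neighbor_sub (n : nat) (x u : V) :
  adj x u -> ball adj n u `<=` ball adj n.+1 x.
Proof. by move=> xu v [p [up uv sp]]; exists (u :: p); rewrite /= xu. Qed.

Lemma colored_ball_pred (n : nat) (x y : V) :
  colored_ball adj phi n.+1 x = colored_ball adj phi n.+1 y ->
  colored_ball adj phi n x = colored_ball adj phi n y.
Proof.
by move=> /colored_ballP[f fP]; apply/colored_ballP; exists f; apply: iso_ball_pred.
Qed.

Lemma colored_ball_le (m n : nat) (x y : V) : (m <= n)%N ->
  colored_ball adj phi n x = colored_ball adj phi n y ->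
  colored_ball adj phi m x = colored_ball adj phi m y.
Proof.
move=> /subnKC <-; elim: (n - m)%N => [|i IH]; first by rewrite addn0.
by rewrite addnS => /colored_ball_pred.
Qed.

(** An isomorphism [f] of [n.+1]-balls respects centers, hence sends [u] to a neighbor of [y], and
    it restricts to the [n]-ball around [u]. *)
Lemma colored_ball_neighbor (n : nat) (x y u : V) :
  colored_ball adj phi n.+1 x = colored_ball adj phi n.+1 y -> adj x u ->
  exists2 v, adj y v & colored_ball adj phi n u = colored_ball adj phi n v.
Proof.
move=> /colored_ballP[f fP] xu; have fx := iso_ball_center fP.
have [g [gP fK gK]] := is_colored_iso_inv fP.
have xSu := ball_adj (ball_center adj n x) xu.
have yfu : adj y (f u).
  case: fP => _ fadj _; rewrite -fx fadj//; exact: ball_center.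
exists (f u) => //; apply/colored_ballP; exists f.
apply: (is_colored_iso_restr fP gK); try exact: ball_neighbor_sub.
  by move=> v; apply: (iso_ball_neighbor fP).
by move=> v /(iso_ball_neighbor gP yfu); rewrite fK// inE.
Qed.

Lemma colored_ball_color (x y : V) :
  colored_ball adj phi 0 x = colored_ball adj phi 0 y -> phi x = phi y.
Proof.
move=> /colored_ballP[f fP]; rewrite -(iso_ball_center fP).
by case: fP => _ _ ->//; exact: ball_center.
Qed.

(** Each step of the walk costs one unit of radius. *)
Lemma colored_ball_path (p : seq V) (n : nat) (x y : V) :
  colored_ball adj phi (n + size p) x = colored_ball adj phi (n + size p) y ->
  path adj x p ->
  exists q, [/\ path adj y q, size q = size p
    & colored_ball adj phi n (last x p) = colored_ball adj phi n (last y q)].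
Proof.
elim: p x y => [|u p IH] x y /=; first by rewrite addn0; exists [::].
rewrite addnS => exy /andP[xu up].
have [v yv /IH[//|q [vq sq e]]] := colored_ball_neighbor exy xu.
by exists (v :: q); rewrite /= yv sq.
Qed.

Lemma ball_seq (n : nat) (x : V) : exists s : seq V, ball adj n x `<=` [set` s].
Proof.
elim: n => [|n IHn] in x *.
  by exists [:: x] => y /ball0 -> /=; rewrite inE.
have [t tP] := neighbors_seq x.
have /choice[b bP] : forall y, exists s : seq V, ball adj n y `<=` [set` s].
  by move=> y; apply: IHn.
exists (x :: flatten (map b t)) => z [[|y p] [/= xp <- sp]].
  by rewrite inE eqxx.
rewrite inE; apply/orP; right; apply/flattenP; exists (b y).
  by apply: map_f; apply: tP; case/andP: xp.
by apply: bP; exists p; split=> //; case/andP: xp.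
Qed.

(** * Sturmian colorings: the unique special class at each level *)

Context (hS : sturmian adj phi).
Local Notation cb := (colored_ball adj phi).

Lemma ball_reps (n : nat) : exists r : 'I_n.+2 -> V,
  injective (cb n \o r) /\ forall z, exists i, cb n (r i) = cb n z.
Proof.
have := hS n; rewrite addn2 => /card_eq_ord[r [rI rV rS]].
have /choice[s sE] : forall i, exists x, cb n x = r i.
  by move=> i; have [x _ <-] := rV i; exists x.
exists s; split; first by move=> i j /=; rewrite !sE; apply: rI.
by move=> z; have [|i ri] := rS (cb n z); [exists z | exists i; rewrite sE].
Qed.

(** Restriction maps the [n + 3] classes of level [n.+1] onto the [n + 2] classes of level [n], so
    exactly one fiber has two elements, the classes of [a] and [b]. *)
Lemma special_split (n : nat) : exists a b : V,
  [/\ cb n a = cb n b, cb n.+1 a <> cb n.+1 b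
    & forall z z', cb n z = cb n z' -> cb n.+1 z <> cb n.+1 z' ->
        cb n.+1 z = cb n.+1 a \/ cb n.+1 z = cb n.+1 b].
Proof.
have [r [rI rS]] := ball_reps n.+1; have [s [sI sS]] := ball_reps n.
have /choice[h hE] : forall i, exists j, cb n (s j) = cb n (r i).
  by move=> i; apply: sS.
have hs j : exists i, h i = j.
  have [i /colored_ball_pred e] := rS (s j).
  by exists i; apply: sI; rewrite /= hE.
have [i [j [nij hij ij]]] := surjection_ord_collapse _ _ hs.
exists (r i), (r j); split.
- by rewrite -!hE hij.
- by move=> /rI /eqP; rewrite (negbTE nij).
move=> z z'; have [p pz] := rS z; have [q qz'] := rS z'.
have [pn qn] := (colored_ball_pred pz, colored_ball_pred qz').
rewrite -pz -qz' -[cb n z]pn -[cb n z']qn => e ne.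
have [||->|->] := ij p q; [| |by left|by right].
  by apply/eqP => pq; apply: ne; rewrite pq.
by apply: sI; rewrite /= !hE.
Qed.

(** One of the two witnesses in [special] must differ from [x] at level [n.+1], so [x] can replace
    the other. *)
Lemma type_setP (n : nat) (x : V) : type_set adj phi x n <->
  exists y, cb n x = cb n y /\ cb n.+1 x <> cb n.+1 y.
Proof.
split=> [[y [z [yx zx nyz]]]|[y [xy nxy]]]; last by exists x, y; split.
have [e|ne] := pselect (cb n.+1 x = cb n.+1 y); last by exists y.
by exists z; split=> // xz; apply: nyz; rewrite -[LHS]e -[RHS]xz.
Qed.

Lemma type_set_eq (n : nat) (x y : V) :
  cb n x = cb n y -> type_set adj phi x n -> type_set adj phi y n.
Proof. by rewrite /type_set /= => ->. Qed.

Lemma special_exists (n : nat) : exists x, type_set adj phi x n.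
Proof. by have [a [b [ab nab _]]] := special_split n; exists a; apply/type_setP; exists b. Qed.

Lemma special_two_classes (n : nat) (x y u : V) :
  type_set adj phi x n -> type_set adj phi y n -> type_set adj phi u n ->
  cb n.+1 x <> cb n.+1 y -> cb n.+1 u = cb n.+1 x \/ cb n.+1 u = cb n.+1 y.
Proof.
have [a [b [_ _ abP]]] := special_split n.
move=> /type_setP[x' [xx' /(abP _ _ xx') X]] /type_setP[y' [yy' /(abP _ _ yy') Y]].
move=> /type_setP[u' [uu' /(abP _ _ uu') U]].
by case: X => ->; case: Y => ->; case: U => ->; tauto.
Qed.

Lemma special_unique (n : nat) (x y : V) :
  type_set adj phi x n -> type_set adj phi y n -> cb n x = cb n y.
Proof.
have [a [b [ab _ abP]]] := special_split n.
suff H z : type_set adj phi z n -> cb n z = cb n a by move=> /H -> /H ->.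
move=> /type_setP[z' [zz' /(abP _ _ zz')[|]]] /colored_ball_pred // zb.
exact: etrans zb (esym ab).
Qed.

(** * Final classes: [stable N x] puts [x] in a final class at level [N] *)

Definition stable (N : nat) (x : V) : Prop :=
  forall n, (N <= n)%N -> ~ type_set adj phi x n.

Lemma stable_eq (N : nat) (x y : V) :
  stable N x -> cb N x = cb N y -> forall n, cb n x = cb n y.
Proof.
move=> sx e n; have [nN|/ltnW Nn] := leqP n N; first exact: colored_ball_le e.
rewrite -(subnKC Nn); elim: (n - N)%N => [|i IH]; first by rewrite addn0.
rewrite addnS; apply: contrapT => ne; apply: (sx (N + i)%N); first exact: leq_addr.
by apply/type_setP; exists y.
Qed.

(* Each splitting of the class of [y] past level [N] strictly increases the
   number of classes adjacent to [x], which is at most [k]. *)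
Lemma stable_neighbor (N : nat) (x y : V) :
  stable N x -> adj x y -> exists M, stable M y.
Proof.
move=> sx xy; have [s sP] := neighbors_seq x.
(* [J v] is a level at which [v] and [y] already differ, if they ever do. *)
have /choice[J JP] : forall v, exists j,
    cb j v = cb j y -> forall n, cb n v = cb n y.
  move=> v; have [/existsNP[j nj]|H] := pselect (~ forall n, cb n v = cb n y).
    by exists j.
  by exists 0%N => _; apply: contrapT.
exists (maxn N.+1 (\max_(v <- s) J v)) => n.
rewrite geq_max => /andP[Nn Jn] /type_setP[y' [yy' nyy']].
case: n => // n in Nn Jn yy' nyy' *.
have yx : adj y x by rewrite adjC.
have [x' y'x' /(colored_ball_le (n := n) Nn) xx'] := colored_ball_neighbor yy' yx.
have {}xx' := stable_eq sx xx'.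
have x'y' : adj x' y' by rewrite adjC.
(* The neighbor [v] of [x] agrees with [y'] at level [n.+2], hence with [y] at level [n.+1]. By the
   choice of [J] it agrees with [y] forever, so [y] and [y'] do not separate. *)
have [v xv vy'] := colored_ball_neighbor (esym (xx' n.+3)) x'y'.
apply: nyy'; rewrite [RHS]vy'; apply/esym/(JP v).
apply: (@colored_ball_le _ n.+1).
  by apply: leq_trans Jn; apply: (leq_bigmax_seq (F := J)) => //; apply: sP.
exact: etrans (esym (colored_ball_pred vy')) (esym yy').
Qed.

Context (hB : bounded_type adj phi).

Lemma stable_all (x : V) : exists N, stable N x.
Proof.
have [x0 /finite_seqP[s sE]] := hB.
have st0 : exists N, stable N x0.
  exists (\max_(i <- s) i).+1 => n sn ns.
  have : n \in s by have : [set` s] n by rewrite -sE.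
  move=> /(leq_bigmax_seq (F := id)) /(_ isT); rewrite leqNgt.
  by rewrite sn.
have [_ _ conn _ _] := hT; have [p xp <-] := conn x0 x.
elim: p x0 st0 xp {sE} => //= y p IH x0 [N st0] /andP[x0y yp].
by apply: IH yp; apply: stable_neighbor st0 x0y.
Qed.

(** [N] is the least level at which [x] is stable. The shift by one keeps levels natural, with
    [N = 0] for an empty type set. *)
Lemma max_type_level (x : V) : exists N : nat,
  [/\ stable N x, (forall M, N = M.+1 -> type_set adj phi x M)
    & max_type adj phi x = N%:Z - 1].
Proof.
have exN : exists N, `[< stable N x >].
  by have [N sN] := stable_all x; exists N; apply/asboolP.
case: (ex_minnP exN) => N /asboolP sN minN.
have tN M : N = M.+1 -> type_set adj phi x M.
  move=> NM; apply: contrapT => nt.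
  suff /asboolP/minN : stable M x by rewrite NM ltnn.
  move=> n; rewrite leq_eqVlt => /orP[/eqP <-//|Mn]; apply: sN.
  by rewrite NM.
exists N; split=> //; rewrite /max_type.
case: N => [|N] in sN minN tN *.
  (* The type set is empty, and the default -1 of [xget] is [0 - 1]. *)
  rewrite xgetPN// => t [[n tn _] _]; exact: sN tn.
have mN : is_max [set n%:Z | n in type_set adj phi x] N%:Z.
  split; first by exists N => //; apply: tN.
  move=> _ [n tn <-]; rewrite lez_nat leqNgt; apply/negP => Nn.
  exact: sN Nn tn.
rewrite -[RHS]/(N.+1%:Z - 1) -[N.+1]addn1 PoszD addrK.
apply: xget_unique => // t [tx tu]; apply/eqP; rewrite eq_le.
by rewrite (mN.2 _ tx) (tu _ mN.1).
Qed.

(** * Distances to the special class *)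

(** Off the special class, the class at level [n] determines the one at [n.+1], hence the
    [n]-classes of the neighbors. A walk to the special class can therefore be copied from any
    equivalent vertex, and [c] is the longest walk chosen from the finitely many representatives. *)
Lemma special_near (n : nat) : exists c : nat, forall z, exists p,
  [/\ path adj z p, (size p <= c)%N & type_set adj phi (last z p) n].
Proof.
have transfer p : forall z z', path adj z p -> type_set adj phi (last z p) n ->
    cb n z = cb n z' -> exists q,
    [/\ path adj z' q, (size q <= size p)%N & type_set adj phi (last z' q) n].
  elim: p => [|y p IH] z z' /= zp tp zz'.
    by exists [::]; split=> //; apply: type_set_eq tp.
  have [tz|ntz] := pselect (type_set adj phi z n).
    by exists [::]; split=> //; apply: type_set_eq tz.
  have [zy yp] := andP zp.
  have e : cb n.+1 z = cb n.+1 z'.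
    by apply: contrapT => ne; apply: ntz; apply/type_setP; exists z'.
  have [y' zy' yy'] := colored_ball_neighbor e zy.
  have [q [y'q sq tq]] := IH _ _ yp tp yy'.
  by exists (y' :: q); rewrite /= zy'.
have [_ _ conn _ _] := hT; have [a ta] := special_exists n.
have [r [_ rS]] := ball_reps n.
have /choice[P PP] : forall i, exists p, path adj (r i) p /\ last (r i) p = a.
  by move=> i; have [p] := conn (r i) a; exists p.
exists (\max_i size (P i)) => z; have [i iz] := rS z; have [iP il] := PP i.
have [|q [zq sq tq]] := transfer _ _ _ iP _ iz; first by rewrite il.
by exists q; split=> //; apply: leq_trans sq _; apply: (leq_bigmax (F := fun i => size (P i))).
Qed.

(* Otherwise every vertex is within a fixed distance of a vertex equivalent at
   all levels to a member of [s], which bounds the number of classes. *)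
Lemma special_far (n d : nat) (s : seq V) :
  ~ forall u, type_set adj phi u n -> exists w p,
      [/\ w \in s, path adj u p, (size p <= d)%N
        & forall j, cb j (last u p) = cb j w].
Proof.
move=> H; have [c cP] := special_near n.
have /choice[B BP] : forall w, exists t : seq V, ball adj (c + d) w `<=` [set` t].
  by move=> w; apply: ball_seq.
(* Level [j] has [j + 2] classes, too many for the [j] entries of [t] to represent. *)
pose t := flatten (map B s); pose j := size t.
have cover z : exists2 b, b \in t & cb j z = cb j b.
  have [p [zp sp /H[w [q [ws pq sq e]]]]] := cP z.
  pose z' := last (last z p) q.
  have [rp [zrp rl srp]] : exists rp, [/\ path adj z' rp, last z' rp = z & (size rp <= c + d)%N].
    exists (rev (belast z (p ++ q))); rewrite /z' -last_cat size_rev size_belast size_cat.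
    rewrite leq_add//; split=> //.
      by rewrite rev_path (eq_path (e' := adj)) ?cat_path ?zp// => u v; rewrite /= adjC.
    by case: (p ++ q) => //= y l; rewrite rev_cons last_rcons.
  (* The walk back from [z'] to [z] is copied from [w], which is equivalent to [z'] at all levels;
     its end lies in [B w] and has the class of [z] at level [j]. *)
  have [rq [wrq srq el]] := colored_ball_path (e (j + size rp)%N) zrp.
  exists (last w rq); last by rewrite -[RHS]el rl.
  apply/flattenP; exists (B w); first exact: map_f.
  by apply: BP; exists rq; rewrite srq.
have [r [rI _]] := ball_reps j.
have : (size [seq cb j (r i) | i <- enum 'I_j.+2] <= size [seq cb j b | b <- t])%N.
  apply: uniq_leq_size; first by rewrite map_inj_uniq ?enum_uniq.
  by move=> _ /mapP[i _ ->]; have [b bt ->] := cover (r i); apply: map_f.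
by rewrite size_map size_enum_ord size_map -/j ltnNge leqnSn.
Qed.

(** * Levels of vertices: [lev x] is the maximal type plus one *)

Context (lev : V -> nat).
Context (stable_lev : forall x, stable (lev x) x).
Context (special_lev : forall x M, lev x = M.+1 -> type_set adj phi x M).

Lemma lev_unbounded (n : nat) : exists x, (n < lev x)%N.
Proof.
have [x tx] := special_exists n; exists x; rewrite ltnNge; apply/negP => xn.
exact: stable_lev tx.
Qed.

Lemma lev_adj (x y : V) : adj x y -> (lev y <= (lev x).+1)%N.
Proof.
move=> xy; rewrite leqNgt; apply/negP.
case ey : (lev y) => [|[|s]] // xs; have ty := special_lev ey.
(* With [lev y = s.+2] and [lev x <= s], the special class at level [s.+1] determines the neighbors
   at level [s], where the class of [x] is already final. *)
apply: (@special_far s.+1 1 [:: x]) => u tu.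
have yx : adj y x by rewrite adjC.
have [x' ux' xx'] := colored_ball_neighbor (special_unique ty tu) yx.
exists x, [:: x']; rewrite inE /= ux'; split=> // j; apply/esym.
exact: stable_eq (@stable_lev x) (colored_ball_le (xs : (lev x <= s)%N) xx') j.
Qed.

Lemma lev_inj (x y : V) : lev x = lev y -> forall n, cb n x = cb n y.
Proof.
case ex : (lev x) => [|t] /esym ey.
  have [sx sy] := (@stable_lev x, @stable_lev y); rewrite ex in sx; rewrite ey in sy.
  apply: (stable_eq sx).
  (* There are only two classes of 0-balls and one is special, so [x] and [y] both lie in the
     other. *)
  have [u tu] := special_exists 0; have [r [_ rS]] := ball_reps 0.
  have [[[i ix] [j jy]] [l lu]] := (rS x, rS y, rS u).
  have il : i != l.
    by apply/eqP => il; apply: (sx 0%N) => //; apply: type_set_eq tu; rewrite -ix -lu il.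
  have jl : j != l.
    by apply/eqP => jl; apply: (sy 0%N) => //; apply: type_set_eq tu; rewrite -jy -lu jl.
  rewrite -ix -jy; congr (cb 0 (r _)); apply: val_inj.
  move: il jl; rewrite -!val_eqE /=.
  by case: i j l {ix jy lu} => [[|[|?]] ?] [[|[|?]] ?] [[|[|?]] ?].
have [tx ty] := (special_lev ex, special_lev ey).
have [sx sy] := (@stable_lev x, @stable_lev y); rewrite ex in sx; rewrite ey in sy.
have [e|ne] := pselect (cb t.+1 x = cb t.+1 y); first exact: stable_eq sx e.
(* Otherwise [x] and [y] represent the two halves of the special class at level [t], and both halves
   are final. *)
exfalso; apply: (@special_far t 0 [:: x; y]) => u tu.
have [ux|uy] := special_two_classes tx ty tu ne.
- by exists x, [::]; rewrite inE eqxx; split=> // j; apply/esym/(stable_eq sx).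
- by exists y, [::]; rewrite !inE eqxx orbT; split=> // j; apply/esym/(stable_eq sy).
Qed.

(** A walk leads from [x] to a vertex of level above [i], and levels rise by at most one per edge.
    The first vertex on it of level at least [i] has level exactly [i]. *)
Lemma lev_intermediate (x : V) (i : nat) : (lev x <= i)%N -> exists y, lev y = i.
Proof.
rewrite leq_eqVlt => /orP[/eqP|]; first by exists x.
case: i => // i xi; have [z iz] := lev_unbounded i.
have [_ _ conn _ _] := hT; have [p] := conn x z.
elim: p x xi => [|y p IH] x /= xi; first by move=> _ e; move: iz; rewrite -e ltnNge -ltnS xi.
move=> /andP[xy yp] pz; have [yi|iy] := leqP (lev y) i; first exact: IH yp pz.
exists y; apply/eqP; rewrite eqn_leq iy andbT.
exact: leq_trans (lev_adj xy) xi.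
Qed.
End ColoredTree.

(** * The quotient graph *)

Lemma quotient_map_eq (V : choiceType) (A : countType) (adj : rel V) (phi : V -> A)
    (v w : V) :
  max_type adj phi v = max_type adj phi w ->
  quotient_map adj phi v = quotient_map adj phi w.
Proof. by move=> /eqP e; apply/eqmodP. Qed.

Lemma quotient_map_repr (V : choiceType) (A : countType) (adj : rel V) (phi : V -> A)
    (q : {eq_quot same_type_equiv adj phi}%qT) :
  quotient_map adj phi (repr q) = q.
Proof. exact: reprK. Qed.

Theorem theorem5 (k : nat) (V : choiceType) (A : countType)
    (adj : rel V) (phi : V -> A)
    (hk : (2 <= k)%N) (hT : regular_tree adj k)
    (hS : sturmian adj phi) (hB : bounded_type adj phi) :
  exists m : int,
    is_min (range (max_type adj phi)) m /\
    [/\ ~ injective (quotient_map adj phi),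
        infinite_set [set: quotient_vertex adj phi],
        injective (label adj phi) /\
          range (label adj phi) = [set t : int | m <= t],
        [set (label adj phi E.1, label adj phi E.2) | E in quotient_edges adj phi] `<=`
          [set (i, i + 1) | i in [set i : int | m <= i]] `|`
          [set (i + 1, i) | i in [set i : int | m <= i]] `|`
          [set (i, i) | i in [set i : int | m <= i]]
      & exists phiX : quotient_vertex adj phi -> A,
          phi = phiX \o quotient_map adj phi].
Proof.
have /choice[lev levP] := max_type_level hk hT hB.
have sl x : stable adj phi (lev x) x by have [] := levP x.
have tl x M : lev x = M.+1 -> type_set adj phi x M by have [_ h _] := levP x; apply: h.
have ml x : max_type adj phi x = (lev x)%:Z - 1 by have [] := levP x.
have lev_max x y : max_type adj phi x = max_type adj phi y -> lev x = lev y.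
  by rewrite !ml => /addIr [].
have lev_nbr x y : adj x y -> (lev y <= (lev x).+1)%N by exact: (lev_adj hk hT hS).
have adjC : symmetric adj by case: hT.
have irr : irreflexive adj by case: hT.
have ex_lev : exists N, `[< exists x, lev x = N >].
  have [x _] := special_exists hk hT hS 0.
  by exists (lev x); apply/asboolP; exists x.
case: (ex_minnP ex_lev) => m /asboolP[x0 x0m] /= m_min.
have m_le x : (m <= lev x)%N by apply: m_min; apply/asboolP; exists x.
have mx x : m%:Z - 1 <= max_type adj phi x by rewrite ml lerD2r lez_nat.
have range_label : range (label adj phi) = [set t : int | m%:Z - 1 <= t].
  apply/seteqP; split=> [_ [q _ <-]|t /=]; first exact: mx.
  rewrite lerBlDr => mt; have : 0 <= t + 1 by apply: le_trans mt.
  case et : (t + 1) => [i|//] _; rewrite et lez_nat -x0m in mt.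
  have [y yi] := lev_intermediate hk hT hS sl tl mt.
  exists (quotient_map adj phi y) => //.
  by rewrite label_quotient_map ml yi -et addrK.
(* Here [m] is the least level, so the least maximal type is [m - 1], possibly -1. *)
exists (m%:Z - 1); split; first by split; [exists x0; rewrite ?ml ?x0m | move=> _ [x _ <-]].
split.
(* If the quotient map were injective, so would be [lev]. Neighbors of [x0], which has the least
   level [m], would all have level [m.+1], yet there are at least two of them. *)
- move=> qI; have levI x y : lev x = lev y -> x = y.
    by move=> e; apply/qI/quotient_map_eq; rewrite !ml e.
  have [y [z [xy xz nyz]]] := two_neighbors hk hT x0.
  have step v : adj x0 v -> lev v = m.+1.
    move=> xv; apply/eqP; rewrite eqn_leq -{1}x0m lev_nbr//= ltn_neqAle m_le andbT.
    apply/eqP => e; have ev : x0 = v by apply: levI; rewrite x0m.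
    by rewrite -ev irr in xv.
  by apply/nyz/levI; rewrite !step.
- move=> /(finite_image (fun q => absz (label adj phi q - (m%:Z - 1))%R)).
  suff -> : [set absz (label adj phi q - (m%:Z - 1))%R | q in [set: quotient_vertex adj phi]] = [set: nat].
    exact: infinite_nat.
  apply/seteqP; split=> // i _.
  have : range (label adj phi) (m%:Z - 1 + i%:Z) by rewrite range_label /= lerDl.
  by case=> q _ e; exists q => //; rewrite e addrC addrA addNr add0r.
- split=> // q q' e; rewrite -(quotient_map_repr q) -(quotient_map_repr q').
  exact: quotient_map_eq.
- move=> _ [_ [v [w [vw ->]]] <-] /=; rewrite !label_quotient_map.
  have vw1 := lev_nbr _ _ vw; have wv1 : (lev v <= (lev w).+1)%N by apply: lev_nbr; rewrite adjC.
  have [mv mw] := (mx v, mx w); rewrite !ml in mv mw *.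
  have succ i : i.+1%:Z - 1 = i%:Z - 1 + 1 by rewrite -addn1 PoszD addrAC.
  case: (ltngtP (lev v) (lev w)) => c.
  + have -> : lev w = (lev v).+1 by apply/eqP; rewrite eqn_leq vw1.
    by left; left; exists ((lev v)%:Z - 1); rewrite ?succ.
  + have -> : lev v = (lev w).+1 by apply/eqP; rewrite eqn_leq wv1.
    by left; right; exists ((lev w)%:Z - 1); rewrite ?succ.
  + by right; exists ((lev w)%:Z - 1); rewrite ?c.
(* Reading the color at a representative is sound: equal levels give equal classes of 0-balls, hence
   equal colors. *)
- exists (fun q => phi (repr (q : {eq_quot same_type_equiv adj phi}%qT))).
  apply/funext => v /=; apply: (colored_ball_color hk hT).
  apply: (lev_inj hk hT hS sl tl); apply: lev_max.
  by rewrite -[RHS]/(label adj phi (quotient_map adj phi v)) label_quotient_map.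
Qed.
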